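(* Let $a,\delta$ be positive integers with $a<\delta<2a$ and $\gcd(a,\delta)=1$, put $b=a+\delta$, $d=\delta-a$ and $h=(3\delta+a)a$. For $n\ge 0$ let $w_n = n + a\lfloor n/a\rfloor + b\lfloor n/\delta\rfloor$, $\mathcal W_0=\{w_n:n\ge 0\}$, and let $C=(\mathcal W_0-\delta)\cap\mathcal W_0=\{x\in\mathcal W_0 : x+\delta\in\mathcal W_0\}$. Then in one heap-period the number of elements of $C$ is $ad$; that is, for every integer $N\ge 0$, $|C\cap\{N,N+1,\dots,N+h-1\}| = ad$.
   Context: For $X\subseteq\mathbb N$ and $y\in\mathbb N$, $X-y=\{x-y : x\in X,\ x\ge y\}$. The sequence satisfies $w_{n+a\delta}=w_n+h$ for all $n\ge0$, so $h$ is the heap-period of $\mathcal W_0$. *)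

(* Defs.v *)
From mathcomp Require Import all_boot.
From mathcomp Require Import boolp classical_sets functions cardinality.

Set Implicit Arguments.
Unset Strict Implicit.
Unset Printing Implicit Defensive.

Local Open Scope classical_set_scope.

(* X - y: the elements of X below y are discarded, so that the truncated
   subtraction of nat is a genuine one here. *)
Definition set_subn (X : set nat) (y : nat) : set nat :=
  [set (x - y)%N | x in X `&` [set x | (y <= x)%N]].

Definition w (a b delta n : nat) : nat :=
  (n + a * (n %/ a) + b * (n %/ delta))%N.

Definition W0 (a b delta : nat) : set nat := range (w a b delta).

Definition C (a b delta : nat) : set nat :=
  set_subn (W0 a b delta) delta `&` W0 a b delta.

Lemma CE (a b delta : nat) :
  C a b delta = [set x | W0 a b delta x /\ W0 a b delta (x + delta)%N].
Proof.
apply/seteqP; split=> x /=.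
  by case=> -[y [Wy /= le_dy] <-] Wx; split=> //; rewrite subnK.
by case=> Wx Wxd; split=> //; exists (x + delta)%N; rewrite ?addnK //=;
  split=> //=; rewrite leq_addl.
Qed.

(* Main.v *)
Require Import Defs.
From mathcomp Require Import all_boot.
From mathcomp Require Import boolp classical_sets functions cardinality.
From mathcomp Require Import zify.

(* Since [b > delta], a jump of [delta] from [w n] crosses no multiple of [delta];
   since [delta < 2 * a], it crosses exactly one multiple of [a].  So the jump is from
   [w n] to [w (n + d)], and it exists exactly when [n %% a >= a - d] and
   [n %% delta < a].  By the Chinese remainder theorem these two conditions
   select [d * a] of the [a * delta] indices of a period. *)

Local Open Scope classical_set_scope.
Local Open Scope card_scope.

Lemma chinese_window_exists m1 m2 N r1 r2 :
    coprime m1 m2 -> (0 < m1)%N -> (0 < m2)%N ->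
  exists n, [/\ (N <= n < N + m1 * m2)%N, n = r1 %[mod m1] & n = r2 %[mod m2]].
Proof.
move=> co_m m1_gt0 m2_gt0; set M := (m1 * m2)%N; set c := chinese m1 m2 r1 r2.
have M_gt0 : (0 < M)%N by rewrite muln_gt0 m1_gt0.
(* Adding [N * M.-1] amounts to subtracting [N] modulo [M], so [n] is the representative of [c] in
   the window starting at [N]. *)
pose n := (N + (c + N * M.-1) %% M)%N.
have nE : n = c %[mod M].
  rewrite /n modnDmr; have -> : (N + (c + N * M.-1) = N * M + c)%N by nia.
  by rewrite modnMDl.
exists n; split.
- by rewrite leq_addr ltn_add2l ltn_mod.
- have dvd1 : (m1 %| M)%N by rewrite dvdn_mulr.
  by rewrite -(modn_dvdm _ dvd1) nE (modn_dvdm _ dvd1) chinese_modl.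
- have dvd2 : (m2 %| M)%N by rewrite dvdn_mull.
  by rewrite -(modn_dvdm _ dvd2) nE (modn_dvdm _ dvd2) chinese_modr.
Qed.

Lemma chinese_window_unique m1 m2 N n n' :
    coprime m1 m2 -> (N <= n < N + m1 * m2)%N -> (N <= n' < N + m1 * m2)%N ->
  n = n' %[mod m1] -> n = n' %[mod m2] -> n = n'.
Proof.
move=> co_m nN n'N /eqP eq1 /eqP eq2.
have: n == n' %[mod m1 * m2] by rewrite chinese_remainder // eq1 eq2.
wlog le_nn' : n n' nN n'N {eq1 eq2} / (n <= n')%N => [hwlog|].
  by case/orP: (leq_total n n') => le; [|rewrite eq_sym => eqm; symmetry; move: eqm];
    apply: hwlog.
rewrite eq_sym eqn_mod_dvd // => dvd_nn'.
have [|] := posnP (n' - n); first by lia.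
by move=> /dvdn_leq/(_ dvd_nn'); lia.
Qed.

(** In a window of length [m1 * m2] an index is determined by its pair of residues, and every pair
    occurs. The allowed pairs are indexed by Euclidean division of [x < k2 * k1] by [k2]: the
    quotient selects one of the top [k1] residues modulo [m1], the remainder one of the bottom [k2]
    modulo [m2]. *)
Lemma card_chinese_window m1 m2 N k1 k2 :
    coprime m1 m2 -> (0 < m1)%N -> (0 < m2)%N -> (k1 <= m1)%N -> (k2 <= m2)%N ->
  [set n | (N <= n < N + m1 * m2)%N /\ (m1 - k1 <= n %% m1)%N /\ (n %% m2 < k2)%N]
    #= `I_(k2 * k1).
Proof.
move=> co_m m1_gt0 m2_gt0 le_k1 le_k2.
rewrite card_eq_sym; apply/card_set_bijP.
have [f fP] := choice (fun x =>
  chinese_window_exists m1 m2 N (m1 - k1 + x %/ k2) (x %% k2) co_m m1_gt0 m2_gt0).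
have f_mod x : (x < k2 * k1)%N ->
    f x %% m1 = (m1 - k1 + x %/ k2)%N /\ f x %% m2 = (x %% k2)%N.
  move=> lt_x; have [_ -> ->] := fP x.
  have k2_gt0 : (0 < k2)%N by case: k2 lt_x {le_k2 fP}.
  have lt_q : (x %/ k2 < k1)%N by rewrite ltn_divLR // mulnC.
  have lt_r : (x %% k2 < k2)%N by rewrite ltn_mod.
  by rewrite [(_ + _) %% m1]modn_small ?[(x %% k2) %% m2]modn_small //; lia.
exists f; split.
- move=> x /= lt_x; have [-> ->] := f_mod x lt_x; have [-> _ _] := fP x.
  by split=> //; rewrite leq_addr ltn_mod; split=> //; case: k2 lt_x {le_k2 fP f_mod}.
- move=> x y /set_mem/= lt_x /set_mem/= lt_y eq_f.
  have [] := f_mod x lt_x; have [] := f_mod y lt_y; rewrite -eq_f => -> -> /addnI eq_q eq_r.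
  by rewrite (divn_eq x k2) (divn_eq y k2) eq_q eq_r.
- move=> n /= [nN [ge_n lt_n]].
  have k2_gt0 : (0 < k2)%N by apply: leq_trans lt_n.
  have lt_n1 : (n %% m1 < m1)%N by rewrite ltn_mod.
  (* The two residues of [n] are the base-[k2] digits of its preimage. *)
  pose x := ((n %% m1 - (m1 - k1)) * k2 + n %% m2)%N.
  have lt_x : (x < k2 * k1)%N.
    have lt_q : (n %% m1 - (m1 - k1) < k1)%N by lia.
    by rewrite /x mulnC; have := leq_mul (leqnn k2) lt_q; rewrite mulnS; lia.
  exists x => //; have [] := f_mod x lt_x.
  rewrite /x divnMDl // modnMDl (divn_small lt_n) (modn_small lt_n) addn0 subnKC // => e1 e2.
  by apply: chinese_window_unique co_m _ nN e1 e2; have [] := fP x.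
Qed.

Section HeapSequence.
Variables a b delta : nat.
Local Notation w := (w a b delta).

Lemma ltn_w m n : (m < n)%N -> (w m < w n)%N.
Proof.
move=> lt_mn; rewrite /Defs.w -!addnA -addSn leq_add // leq_add // leq_mul //;
  exact/leq_div2r/ltnW.
Qed.

Lemma leq_w : {mono w : m n / (m <= n)%N}.
Proof. exact/leq_mono/ltn_w. Qed.

Lemma w_inj : injective w.
Proof. by move=> m n /eqP; rewrite eqn_leq !leq_w -eqn_leq => /eqP. Qed.

Lemma wD_period n : (0 < a)%N -> (0 < delta)%N ->
  w (n + a * delta) = (w n + (a * delta + a * delta + b * a))%N.
Proof.
move=> a_gt0 delta_gt0; rewrite /Defs.w divnDMl //.
by rewrite [(n + a * delta) %/ a]divnDr ?dvdn_mulr // mulKn //; lia.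
Qed.

(** This turns counting heap values into counting indices: [w] is increasing, so with [n0] the first
    index whose value reaches [N], a period of values is exactly a period of indices from [n0]
    on. *)
Lemma w_window N : (0 < a)%N -> (0 < delta)%N ->
  exists n0, forall n,
    (N <= w n < N + (a * delta + a * delta + b * a))%N = (n0 <= n < n0 + a * delta)%N.
Proof.
move=> a_gt0 delta_gt0; have wD n := wD_period n a_gt0 delta_gt0.
have exN : exists n, (N <= w n)%N by exists N; rewrite /Defs.w -addnA leq_addr.
have [n0 le_N min_n0] := find_ex_minn exN.
exists n0 => n.
have -> : (N <= w n)%N = (n0 <= n)%N.
  apply/idP/idP => [/min_n0 //|le_n]; by rewrite (leq_trans le_N) ?leq_w.
congr (_ && _); apply/idP/idP; rewrite ltnNge => lt_n; rewrite ltnNge; apply: contra lt_n.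
  by rewrite -leq_w wD => /(leq_trans _); apply; rewrite leq_add2r.
have [n_ge|n_lt] := leqP (a * delta) n.
  rewrite -(subnK n_ge) wD leq_add2r => /min_n0; lia.
(* Here [n] cannot be shifted back by a period, but then [w n < w (a * delta)], which is the
   heap-period itself, so [w n] cannot reach [N] plus that period. *)
move=> le_w; have := ltn_w _ _ n_lt.
have := wD 0%N; have -> : w 0 = 0%N by rewrite /Defs.w !div0n !muln0.
by rewrite !add0n => ->; lia.
Qed.

End HeapSequence.

Lemma w_jumpP a delta n : (a < delta)%N -> (delta < 2 * a)%N ->
  W0 a (a + delta) delta (w a (a + delta) delta n + delta) <->
  (a - (delta - a) <= n %% a)%N /\ (n %% delta < a)%N.
Proof.
move=> lt_a lt_delta.
have a_gt0 : (0 < a)%N by lia.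
have delta_gt0 : (0 < delta)%N by lia.
have lt_na : (n %% a < a)%N by rewrite ltn_mod.
have lt_nd : (n %% delta < delta)%N by rewrite ltn_mod.
have En := divn_eq n a; have Fn := divn_eq n delta.
split=> [[n' _]|[ge_n lt_n]]; last first.
  (* The index grows by [delta - a] and the crossed multiple of [a] contributes [a]: in all
     [delta]. *)
  exists (n + (delta - a))%N => //; rewrite /w.
  have -> : (n + (delta - a)) %/ a = (n %/ a).+1.
    by apply/eqP; rewrite eqn_leq -ltnS ltn_divLR // leq_divRL //; lia.
  have -> : (n + (delta - a)) %/ delta = n %/ delta.
    by apply/eqP; rewrite eqn_leq -ltnS ltn_divLR // leq_divRL //; lia.
  lia.
move=> eq_w; have le_n : (n <= n')%N.
  by rewrite -(leq_w a (a + delta) delta) eq_w leq_addr.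
move: eq_w; rewrite /w.
have := leq_div2r a le_n; have := leq_div2r delta le_n.
have lt_n'a : (n' %% a < a)%N by rewrite ltn_mod.
have lt_n'd : (n' %% delta < delta)%N by rewrite ltn_mod.
have En' := divn_eq n' a; have Fn' := divn_eq n' delta.
move: (n %/ a) (n' %/ a) (n %/ delta) (n' %/ delta) En En' Fn Fn' => q q' p p'.
move=> En En' Fn Fn' le_p le_q eq_w.
(* A larger [p'] would add at least [a + delta], more than the jump. *)
have eq_p : p' = p by nia.
rewrite eq_p in eq_w Fn'.
have [j eq_q] : exists j, q' = (q + j)%N by exists (q' - q)%N; lia.
(* If [j = 0], then [n' = n + delta], which contradicts [p' = p]; if [j >= 2], the jump is at least
   [2 * a > delta]. *)
have j1 : j = 1%N by case: j eq_q => [|[|j]] eq_q //; rewrite eq_q in eq_w; nia.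
subst; lia.
Qed.

Theorem theorem4p1 (a delta b d h : nat)
  (a_gt0 : (0 < a)%N) (delta_gt0 : (0 < delta)%N)
  (lt_a_delta : (a < delta)%N) (lt_delta_2a : (delta < 2 * a)%N)
  (gcd_a_delta : gcdn a delta = 1%N)
  (bE : b = (a + delta)%N) (dE : d = (delta - a)%N)
  (hE : h = ((3 * delta + a) * a)%N) :
  forall N : nat,
    C a b delta `&` [set x | (N <= x < N + h)%N] #= `I_(a * d).
Proof.
subst b d => N; have [n0 n0P] := w_window a (a + delta) delta N a_gt0 delta_gt0.
have {}hE : h = (a * delta + a * delta + (a + delta) * a)%N by rewrite hE; lia.
have co : coprime a delta by rewrite /coprime gcd_a_delta.
have := card_chinese_window a delta n0 (delta - a) a co a_gt0 delta_gt0.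
have -> : (delta - a <= a)%N by lia.
rewrite (ltnW lt_a_delta) => /(_ isT isT).
apply: card_eq_trans.
set S := [set n | _ /\ _].
(* [S] has the required cardinality, and the injective [w] carries it onto the part of [C] in the
   window. *)
have -> : C a (a + delta) delta `&` [set x | (N <= x < N + h)%N] = w a (a + delta) delta @` S.
  rewrite CE hE; apply/seteqP; split=> x /=.
    move=> [[[n _ <-] /w_jumpP jump] xN]; exists n => //; split; first by rewrite -n0P.
    exact: jump.
  move=> [n [nN jump] <-]; rewrite n0P nN; do !split=> //; first by exists n.
  exact/w_jumpP.
by apply: inj_card_eq => m n _ _ /w_inj.
Qed.
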